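(* Let $p\ge 0$ be an integer, let $G$ be a minimal forbidden interval subgraph for the class of $p$-improper interval graphs, and let $\alpha$ be a minimal representation of $G$. Let $H$ be a confined, non-exterior side component of $G$ (with respect to $\alpha$). Then $H$ consists of a blocking set $B$, of maximum order among the interior potential blocking sets of $G$ (with respect to $\alpha$), and some set of vertices that contribute to the impropriety of $G$ (the contributory set). Furthermore, if $B$ has $n$ vertices, then the number of vertices of $B$ that are adjacent to at least one vertex of the contributory set is at least $1$ and at most $n-1$.
   Context: All graphs are finite and simple. An interval graph is a graph $G=(V,E)$ having a representation $\alpha: v\mapsto I_v$ by intervals of the real line such that, for distinct $v,w$, $vw\in E$ if and only if $I_v\cap I_w\neq\emptyset$. $G$ is $p$-improper if it has a representation in which no interval properly contains more than $p$ other intervals. The impropriety $\mathrm{imp}(G)$ is the smallest $p$ such that $G$ is $p$-improper. A representation is minimal if the maximum number of intervals properly contained in a single interval equals $\mathrm{imp}(G)$. A minimal forbidden interval subgraph for the class of $p$-improper interval graphs is an interval graph that is not $p$-improper but all of whose proper (induced) subgraphs are $p$-improper. A basepoint of $G$ is a vertex $z$ such that in every representation $I_z$ properly contains the intervals of at least $\mathrm{imp}(G)$ other vertices; ''the basepoint'' denotes this vertex $z$. The local components of $G$ are the connected components of $G\setminus\{z\}$; the support of a local component is the union of the intervals of its vertices. Given a representation, order the local components $H_0,\dots,H_m$ by their supports from left to right; $H_0$ and $H_m$ are the side components. A potential side component is a local component that is a side component in some representation. A vertex contributes to the impropriety of $G$ in a representation if its interval is properly contained in $I_z$. A side component is exterior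 if it contains at least one vertex at distance at least $2$ from $z$ (such a vertex is called an exterior vertex), and non-exterior otherwise. A potential side component $H$ is unconfined if there is a representation of $G$ in which $H$ contains no vertex that contributes to the impropriety of $G$; it is confined if in every representation it contains at least one such vertex. Given a representation, a blocking set of $G$ is a set of vertices that are adjacent to the basepoint $z$, whose intervals are not properly contained in $I_z$, and that are not adjacent to any exterior vertex of $G$ (it need not be an entire local component). A potential blocking set is a set of vertices of $G$ that can be made into a blocking set by changing the representation of $G$. Given a representation, an interior potential blocking set is a potential blocking set contained in a potential side component that is not an actual side component of that representation. *)

(* Defs.v *)
From mathcomp Require Import all_boot all_order all_algebra.
From mathcomp Require Import all_classical all_reals all_analysis.

Set Implicit Arguments.
Unset Strict Implicit.
Unset Printing Implicit Defensive.

Local Open Scope classical_set_scope.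
Local Open Scope ring_scope.

(* A graph is a finType of vertices with an adjacency relation [e]; that [e] is
   symmetric and irreflexive is a hypothesis of the theorems. *)

Section Impropriety.
Variables (R : realType) (V : finType) (e : rel V).

(* Open, half-open, unbounded and one-point intervals are all allowed. *)
Definition representation (I : V -> set R) : Prop :=
  (forall v, is_interval (I v) /\ I v !=set0) /\
  (forall v w, v != w -> e v w <-> I v `&` I w !=set0).

Definition interval_graph : Prop := exists I, representation I.

Definition contained (I : V -> set R) (v : V) : {set V} :=
  [set w | `[< I w `<` I v >]]%SET.

Definition improper (p : nat) : Prop :=
  exists2 I, representation I & forall v, (#|contained I v| <= p)%N.

(* The default value 0 is only reached when [e] is not an interval graph. *)
Definition impropriety : nat :=
  xget 0%N [set p | improper p /\ forall q, improper q -> (p <= q)%N].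

Definition minimal_representation (I : V -> set R) : Prop :=
  representation I /\ (\max_(v : V) #|contained I v|)%N = impropriety.

Definition basepoint (z : V) : Prop :=
  forall I, representation I -> (impropriety <= #|contained I z|)%N.

Variable z : V.

Definition local_components : {set {set V}} :=
  [set [set y | connect [rel u v | [&& u != z, v != z & e u v]] x y]%SET
  | x in [set~ z]%SET]%SET.

Definition support (I : V -> set R) (H : {set V}) : set R :=
  [set t | exists2 v, v \in H & I v t].

Definition left_of (A B : set R) : Prop := forall a b, A a -> B b -> a < b.

(* [H] is the leftmost or the rightmost local component; both when it is the
   only one. *)
Definition side_component (I : V -> set R) (H : {set V}) : Prop :=
  H \in local_components /\
  ((forall K, K \in local_components -> K != H ->
      left_of (support I H) (support I K)) \/
   (forall K, K \in local_components -> K != H ->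
      left_of (support I K) (support I H))).

Definition potential_side_component (H : {set V}) : Prop :=
  exists2 I, representation I & side_component I H.

Definition contributes (I : V -> set R) (v : V) : Prop := I v `<` I z.

(* Distance at least 2 from [z]: every walk from [z] to [v] has at least two
   edges. *)
Definition exterior_vertex (v : V) : Prop :=
  forall s : seq V, path e z s -> last z s = v -> (2 <= size s)%N.

Definition exterior (H : {set V}) : Prop :=
  exists2 v, v \in H & exterior_vertex v.

Definition confined (H : {set V}) : Prop :=
  potential_side_component H /\
  forall I, representation I -> exists2 v, v \in H & contributes I v.

Definition blocking_set (I : V -> set R) (S : {set V}) : Prop :=
  forall v, v \in S ->
    [/\ e z v, ~ contributes I v & forall w, exterior_vertex w -> ~~ e v w].

Definition potential_blocking_set (S : {set V}) : Prop :=
  exists2 I, representation I & blocking_set I S.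

Definition interior_potential_blocking_set
    (I : V -> set R) (S : {set V}) : Prop :=
  potential_blocking_set S /\
  exists K : {set V},
    [/\ potential_side_component K, ~ side_component I K & S \subset K].

End Impropriety.

(* Minimality ranges over the proper induced subgraphs, each realised on the
   subtype of a proper vertex subset [A]. *)
Definition minimal_forbidden (R : realType) (V : finType) (e : rel V)
    (p : nat) : Prop :=
  [/\ interval_graph R e, ~ improper R e p &
      forall A : {set V}, A \proper [set: V]%SET ->
        improper R (relpre (val : {x : V | x \in A} -> V) e) p].

(* Main.v *)
Require Import Defs.
From mathcomp Require Import all_boot all_order all_algebra.
From mathcomp Require Import all_classical all_reals all_analysis.
From mathcomp Require Import zify.

(* Reflecting the line if necessary, let [H] be the rightmost local component.
   The splitting is forced: [B] and [C] are the non-contributing and the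
   contributing vertices of [H].  Both bounds come from redrawing [alpha] with
   fewer contributors, which the basepoint property forbids.
   If every vertex of [B] had a neighbour in [C], all vertices of [H] would have
   points inside [I_z] that lie in intervals of contributors; truncating [I_z] at
   the largest of these points [t] and prolonging the intervals of [H] through
   [t] to infinity would save a contributor.
   Minimality makes [G] connected, so a component [K] that is not a side
   component of [alpha] contributes entirely.  If [S] in [K] is blocking in [J],
   then redrawing [K] as in [J] to the right of [H] loses [#|B|]
   non-contributors and gains [#|S|], whence [#|S| <= #|B|]. *)

Set Implicit Arguments.
Unset Strict Implicit.
Unset Printing Implicit Defensive.

Import Order.TTheory GRing.Theory Num.Theory.

(** * Disjoint intervals, and copies of the line inside its two half-lines *)

Section Intervals.
Local Open Scope classical_set_scope.
Local Open Scope ring_scope.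
Variable R : realType.
Implicit Types (A B : set R) (x y : R).

(** If [a' <= b'] and [b <= a] violate the two orders, convexity puts the larger of [a'] and [b]
    into both intervals. *)
Lemma left_of_total A B : is_interval A -> is_interval B ->
  ~ (A `&` B !=set0) -> left_of A B \/ left_of B A.
Proof.
move=> iA iB AB; have [|nAB] := pselect (left_of A B); [by left|right].
move=> b' a' Bb' Aa'; rewrite ltNge; apply/negP => a'b'; apply: nAB => a b Aa Bb.
rewrite ltNge; apply/negP => ba; apply: AB.
have [a'b|ba'] := leP a' b.
  by exists b; split => //; apply: (iA a' a) => //; rewrite a'b.
by exists a'; split => //; apply: (iB b b') => //; rewrite (ltW ba').
Qed.

Lemma nonempty_argmax (T : finType) (K : {set T}) (f : T -> R) :
  (exists v, v \in K) -> exists2 a, a \in K & forall v, v \in K -> f v <= f a.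
Proof.
by case=> v0 Kv0; case: (arg_maxP f Kv0) => a Ka amax; exists a.
Qed.

(** [expR] and its conjugate by negation are increasing bijections from the line onto the open
    half-lines. They preserve convexity, meeting and containment, and they separate even unbounded
    drawings. *)
Definition to_pos A : set R := expR @` A.
Definition to_neg A : set R := (fun x => - expR (- x)) @` A.

Lemma to_pos_gt0 A x : to_pos A x -> 0 < x.
Proof. by case=> y _ <-; exact: expR_gt0. Qed.

Lemma to_neg_lt0 A x : to_neg A x -> x < 0.
Proof. by case=> y _ <-; rewrite oppr_lt0 expR_gt0. Qed.

Lemma to_posE A x : to_pos A (expR x) <-> A x.
Proof. by split=> [[y Ay /expR_inj <-]|Ax] //; exists x. Qed.

Lemma to_negE A x : to_neg A (- expR (- x)) <-> A x.
Proof.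
by split=> [[y Ay /oppr_inj/expR_inj/oppr_inj <-]|Ax] //; exists x.
Qed.

Lemma to_pos_interval A : is_interval A -> is_interval (to_pos A).
Proof.
move=> iA _ _ [x Ax <-] [y Ay <-] t /andP[xt ty].
have t0 : 0 < t by apply: lt_le_trans xt; exact: expR_gt0.
exists (ln t); last by rewrite lnK.
by apply: (iA x y) => //; rewrite -[x]expRK -[y]expRK !ler_ln ?posrE ?expR_gt0// xt.
Qed.

Lemma to_neg_interval A : is_interval A -> is_interval (to_neg A).
Proof.
move=> iA _ _ [x Ax <-] [y Ay <-] t /andP[xt ty].
have t0 : 0 < - t.
  by rewrite oppr_gt0; apply: le_lt_trans ty _; rewrite oppr_lt0 expR_gt0.
exists (- ln (- t)); last by rewrite opprK lnK// opprK.
apply: (iA x y) => //; rewrite lerNr lerNl.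
rewrite -[- x]expRK -[- y]expRK !ler_ln ?posrE ?expR_gt0//.
by rewrite lerNl xt lerNr.
Qed.

Lemma to_pos_meet A B : to_pos A `&` to_pos B !=set0 <-> A `&` B !=set0.
Proof.
split=> [[_ [[x Ax <-]]] /to_posE Bx|[x [Ax Bx]]]; first by exists x.
by exists (expR x); split; apply/to_posE.
Qed.

Lemma to_neg_meet A B : to_neg A `&` to_neg B !=set0 <-> A `&` B !=set0.
Proof.
split=> [[_ [[x Ax <-]]] /to_negE Bx|[x [Ax Bx]]]; first by exists x.
by exists (- expR (- x)); split; apply/to_negE.
Qed.

Lemma to_pos_proper A B : to_pos A `<` to_pos B -> A `<` B.
Proof.
case=> AB nBA; split=> [x Ax|BA]; first by apply/to_posE/AB/to_posE.
by apply: nBA => _ [x Bx <-]; apply/to_posE/BA.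
Qed.

Lemma to_neg_proper A B : to_neg A `<` to_neg B -> A `<` B.
Proof.
case=> AB nBA; split=> [x Ax|BA]; first by apply/to_negE/AB/to_negE.
by apply: nBA => _ [x Bx <-]; apply/to_negE/BA.
Qed.

Lemma to_neg_pos_disjoint A B : ~ (to_neg A `&` to_pos B !=set0).
Proof.
case=> x [/to_neg_lt0 x0 /to_pos_gt0 /(lt_trans x0)].
by rewrite ltxx.
Qed.

End Intervals.

(** * Drawings of part of a graph, juxtaposition and reflection *)

Section Representations.
Local Open Scope classical_set_scope.
Local Open Scope ring_scope.
Variables (R : realType) (V : finType) (e : rel V).
Implicit Types (I J : V -> set R) (A B : {set V}).

(** Drawings stay defined on all of [V], so that those of different vertex sets can be merged
    without subtypes. *)
Definition represents_on A I : Prop :=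
  (forall v, v \in A -> is_interval (I v) /\ I v !=set0) /\
  (forall v w, v \in A -> w \in A -> v != w -> e v w <-> I v `&` I w !=set0).

Lemma representation_on A I : representation e I -> represents_on A I.
Proof. by case=> i a; split => [v _|v w _ _]; [exact: i|exact: a]. Qed.

Lemma in_contained I v w : (w \in contained I v) <-> I w `<` I v.
Proof. by rewrite inE; split => [/asboolP|?] //; apply/asboolP. Qed.

(* The parts are placed side by side: the vertices outside [A] on the negative
   half-line, those of [A] on the positive one. *)
Definition juxtapose A I J (v : V) : set R :=
  if v \in A then to_pos (I v) else to_neg (J v).

Lemma juxtapose_on A B I J : symmetric e ->
  represents_on A I -> represents_on B J ->
  (forall v w, v \in A -> w \in B -> w \notin A -> ~~ e v w) ->
  represents_on (A :|: B)%SET (juxtapose A I J).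
Proof.
move=> es [iI aI] [iJ aJ] nAB; split=> [v|v w]; rewrite /juxtapose !inE.
  case: (boolP (v \in A)) => [vA _|_ /= vB].
    have [? [x Ix]] := iI _ vA; split; first exact: to_pos_interval.
    by exists (expR x), x.
  have [? [x Jx]] := iJ _ vB; split; first exact: to_neg_interval.
  by exists (- expR (- x)), x.
case: (boolP (v \in A)) => [vA _|nvA /= vB]; case: (boolP (w \in A)).
- by move=> wA _ vw; rewrite to_pos_meet; exact: aI.
- move=> nwA /= wB vw; rewrite (negbTE (nAB _ _ vA wB nwA)); split => //.
  by rewrite setIC => /to_neg_pos_disjoint.
- move=> wA _ vw; rewrite es (negbTE (nAB _ _ wA vB nvA)); split => //.
  by move=> /to_neg_pos_disjoint.
- by move=> nwA /= wB vw; rewrite to_neg_meet; exact: aJ.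
Qed.

(** The mirror image serves twice: it turns a leftmost component into a rightmost one, and it lets a
    second drawing be oriented to suit the first. *)
Definition reflect_rep I (v : V) : set R := [set x | I v (- x)].

Lemma reflect_rep_representation I :
  representation e I -> representation e (reflect_rep I).
Proof.
case=> i a; split=> [v|v w vw].
  have [iv [x Ix]] := i v; split; last by exists (- x); rewrite /reflect_rep /= opprK.
  move=> x1 y1 Ix1 Iy1 t /andP[xt ty]; apply: (iv (- y1) (- x1)) => //.
  by rewrite !lerN2 xt ty.
rewrite a//; split=> -[x [Ix Jx]]; exists (- x); split => //=;
  by rewrite /reflect_rep /= opprK.
Qed.

Lemma reflect_rep_sub I v w :
  (reflect_rep I v `<=` reflect_rep I w) = (I v `<=` I w).
Proof.
apply/propext; split => H x Ix; last exact: H.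
by rewrite -(opprK x); apply: H; rewrite /reflect_rep /= opprK.
Qed.

Lemma reflect_rep_contributes z I v :
  contributes z (reflect_rep I) v = contributes z I v.
Proof. by rewrite /contributes /proper !reflect_rep_sub. Qed.

Lemma reflect_rep_contained I v : contained (reflect_rep I) v = contained I v.
Proof.
apply/setP => w; apply/idP/idP => /in_contained H; apply/in_contained;
  (* [contributes] with [v] in the place of the basepoint is membership in [contained _ v]. *)
  by have := reflect_rep_contributes v I w; rewrite /contributes => E;
  rewrite ?E // -E.
Qed.

Lemma reflect_rep_left_of I A B :
  left_of (Defs.support (reflect_rep I) A) (Defs.support (reflect_rep I) B) <->
  left_of (Defs.support I B) (Defs.support I A).
Proof.
split=> H x y [v vA Ix] [w wB Iy].
  rewrite -ltrN2; apply: H; [exists w|exists v] => //;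
  by rewrite /reflect_rep /= opprK.
by rewrite -ltrN2; apply: H; [exists w|exists v].
Qed.

Lemma reflect_rep_side_component z I A :
  side_component e z (reflect_rep I) A <-> side_component e z I A.
Proof.
split=> -[HA HK]; split=> //.
  by case: HK => H; [right|left] => K KL KA; apply/reflect_rep_left_of; exact: H.
by case: HK => H; [right|left] => K KL KA; apply/reflect_rep_left_of; exact: H.
Qed.

End Representations.

(** * Local components and the linear order of their supports *)

Section Components.
Local Open Scope classical_set_scope.
Local Open Scope ring_scope.
Variables (R : realType) (V : finType) (e : rel V) (z : V).
Hypothesis es : symmetric e.
Implicit Types (I J : V -> set R) (H K : {set V}).

Let away := [rel u v | [&& u != z, v != z & e u v]].

Let away_sym : connect_sym away.
Proof. by apply: sym_connect_sym => u v /=; rewrite es andbCA. Qed.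

Lemma local_componentP K : K \in local_components e z ->
  exists2 x, x != z & K = [set y | connect away x y]%SET.
Proof. by case/imsetP=> x; rewrite !inE => xz ->; exists x. Qed.

Lemma local_component_notin K : K \in local_components e z -> z \notin K.
Proof.
case/local_componentP=> x xz ->; rewrite inE; apply/negP => xz'.
have cl : fingraph.closed away (predC1 z).
  by apply: intro_closed => // u v /= /and3P[_ vz _] _; rewrite inE.
by have := closed_connect cl xz'; rewrite !inE xz eqxx.
Qed.

Lemma local_component_adj K u v : K \in local_components e z ->
  u \in K -> v != z -> e u v -> v \in K.
Proof.
move=> KL uK vz uv; have uz : u != z.
  by apply: contraTneq uK => ->; exact: local_component_notin.
case/local_componentP: KL uK => x _ -> ; rewrite !inE => xu.
by apply: connect_trans xu _; apply: connect1; rewrite /= uz vz.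
Qed.

Lemma local_component_cover v : v != z ->
  exists2 K, K \in local_components e z & v \in K.
Proof.
move=> vz; exists [set y | connect away v y]%SET; last by rewrite inE connect0.
by apply/imsetP; exists v; rewrite ?inE.
Qed.

Lemma local_component_eq H K v : H \in local_components e z ->
  K \in local_components e z -> v \in H -> v \in K -> H = K.
Proof.
case/local_componentP=> x _ -> /local_componentP[y _ ->]; rewrite !inE => xv yv.
by apply/setP => u; rewrite !inE (same_connect away_sym xv) (same_connect away_sym yv).
Qed.

Lemma local_component_nonempty K : K \in local_components e z ->
  exists v, v \in K.
Proof.
by case/local_componentP=> x _ ->; exists x; rewrite inE connect0.
Qed.

(** Connectedness as an induction principle. It spreads an order between intervals in
    [support_total], and the property of contributing in the lower bound of the theorem. *)
Lemma local_component_connected K (P : pred V) u v :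
  K \in local_components e z -> u \in K -> v \in K ->
  {in K &, forall a b, e a b -> P a -> P b} -> P u -> P v.
Proof.
move=> KL uK vK PK Pu.
have cl : fingraph.closed away [pred x | (x \in K) && P x].
  apply: intro_closed => // a b /= /and3P[az bz ab] /andP[aK Pa].
  have bK := local_component_adj KL aK bz ab.
  by rewrite inE bK /= (PK a b).
have uv : connect away u v.
  case/local_componentP: KL uK vK => x _ -> ; rewrite !inE => xu.
  by rewrite (same_connect away_sym xu).
by have := closed_connect cl uv; rewrite !inE uK vK /= Pu.
Qed.

(** Adjacent vertices have meeting intervals, which cannot lie on opposite sides of an interval
    disjoint from both. Hence the order of one pair spreads along edges, first in one component and
    then in the other. *)
Lemma support_total I H K : representation e I ->
  H \in local_components e z -> K \in local_components e z -> H != K ->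
  left_of (Defs.support I H) (Defs.support I K) \/
  left_of (Defs.support I K) (Defs.support I H).
Proof.
move=> [i a] HL KL HK.
have dis u v : u \in H -> v \in K -> ~ (I u `&` I v !=set0).
  move=> uH vK; have uv : u != v.
    by apply: contraNneq HK => uv; apply/eqP; apply: (local_component_eq HL KL uH); rewrite uv.
  move/(a _ _ uv) => euv; move/eqP: HK; apply.
  apply: (local_component_eq HL KL _ vK).
  apply: (local_component_adj HL uH) euv.
  by apply: contraTneq vK => ->; exact: local_component_notin.
have tot u v : u \in H -> v \in K -> left_of (I u) (I v) \/ left_of (I v) (I u).
  by move=> uH vK; apply: left_of_total; [exact: (i _).1|exact: (i _).1|exact: dis].
have meet u v : u != v -> e u v -> exists x, I u x /\ I v x.
  by move=> uv /(a _ _ uv)[x [? ?]]; exists x.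
have stepH k u v : k \in K -> u \in H -> v \in H -> e u v ->
    `[< left_of (I u) (I k) >] -> `[< left_of (I v) (I k) >].
  move=> kK uH vH; have [<-//|uv] := eqVneq u v.
  move=> /(meet _ _ uv)[x [Iu Iv]] /asboolP uk; apply/asboolP.
  case: (tot v k) => // vk; have [_ [y Iy]] := i k.
  by have := lt_trans (uk _ _ Iu Iy) (vk _ _ Iy Iv); rewrite ltxx.
have stepK h u v : h \in H -> u \in K -> v \in K -> e u v ->
    `[< left_of (I h) (I u) >] -> `[< left_of (I h) (I v) >].
  move=> hH uK vK; have [<-//|uv] := eqVneq u v.
  move=> /(meet _ _ uv)[x [Iu Iv]] /asboolP uk; apply/asboolP.
  case: (tot h v) => // vk; have [_ [y Iy]] := i h.
  by have := lt_trans (uk _ _ Iy Iu) (vk _ _ Iv Iy); rewrite ltxx.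
have all_left h k u v : h \in H -> k \in K -> u \in H -> v \in K ->
    left_of (I h) (I k) -> left_of (I u) (I v).
  move=> hH kK uH vK /asboolP hk; apply/asboolP.
  apply: (@local_component_connected H (fun x => `[< left_of (I x) (I v) >]) h) => //.
    by move=> ? ? ? ?; exact: stepH.
  apply: (@local_component_connected K (fun x => `[< left_of (I h) (I x) >]) k) => //.
  by move=> ? ? ? ?; exact: stepK.
have [h hH] := local_component_nonempty HL.
have [k kK] := local_component_nonempty KL.
case: (tot h k hH kK) => [hk|kh]; [left|right].
  by move=> x y [u uH Iu] [v vK Iv]; exact: (all_left h k u v).
move=> x y [u uK Iu] [v vH Iv].
case: (tot v u) => // vu; last exact: vu.
(* A single pair in the opposite order would spread to [h] and [k], against [kh]. *)
have := all_left _ _ _ _ vH uK hH kK vu => hk.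
have [_ [p Ip]] := i h; have [_ [q Iq]] := i k.
by have := lt_trans (hk _ _ Ip Iq) (kh _ _ Iq Ip); rewrite ltxx.
Qed.

Lemma non_exterior_adj H : ~ exterior e z H -> forall v, v \in H -> v != z -> e z v.
Proof.
move=> nH v vH vz; apply: contrapT => nzv; apply: nH; exists v => // -[|u [|w s]] //=.
  by move=> _ zv; rewrite zv eqxx in vz.
by rewrite andbT => zu uv; move: nzv; rewrite -uv.
Qed.

End Components.

(** * Two redrawings compared with a drawing that has the fewest contributors *)

Section Surgery.
Local Open Scope classical_set_scope.
Local Open Scope ring_scope.
Variables (R : realType) (V : finType) (e : rel V) (z : V).
Variable alpha : V -> set R.
Hypothesis alpha_rep : representation e alpha.
Hypothesis alpha_min : forall I : V -> set R, representation e I ->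
  (#|contained alpha z| <= #|contained I z|)%N.
Variable H : {set V}.
Hypothesis zH : z \notin H.
Hypothesis Hright : forall w h, w != z -> w \notin H -> h \in H ->
  left_of (alpha w) (alpha h).
Hypothesis Hadj : forall h, h \in H -> e z h.

Lemma exists_free_outer_vertex :
  (exists2 c, c \in H & contributes z alpha c) ->
  exists b, [/\ b \in H, ~ contributes z alpha b &
    forall c, c \in H -> contributes z alpha c -> ~~ e b c].
Proof.
move=> exC; apply: contrapT => nb.
have [iA aA] := alpha_rep.
(* A contributor takes any point of its own interval, another vertex of [H] a point shared with a
   contributing neighbour. Outside [H] the value [0] is a default that lets [choice] apply. *)
have pt v : exists y, v \in H -> [/\ alpha v y, alpha z y &
    exists c, [/\ c \in H, contributes z alpha c & alpha c y]].
  have [vH|] := boolP (v \in H); last by exists 0.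
  have [vC|nvC] := pselect (contributes z alpha v).
    have [_ [y Iy]] := iA v; exists y => _; split=> //; first exact: vC.1.
    by exists v.
  have [c [cH cC vc]] : exists c, [/\ c \in H, contributes z alpha c & e v c].
    apply: contrapT => nc; apply: nb; exists v; split=> // c cH cC.
    by apply/negP => vc; apply: nc; exists c.
  have /(aA _ _)[/(_ vc)[y [vy cy]] _] : v != c.
    by apply: contra_notN nvC => /eqP ->.
  by exists y => _; split=> //; [exact: cC.1|exists c].
have [f fP] := choice pt.
have [a aH amax] : exists2 a, a \in H & forall v, v \in H -> f v <= f a.
  by apply: nonempty_argmax; case: exC => c cH _; exists c.
have [at_ zt [c [cH cC ct]]] := fP a aH.
set t := f a in amax at_ zt ct.
pose S := [set v in H | `[< alpha v t >]]%SET.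
have SP v : v \in S -> alpha v t by rewrite inE => /andP[_ /asboolP].
have zS : z \notin S by rewrite inE (negbTE zH).
(* Cut [z] off after [t] and prolong the vertices of [H] through [t] to infinity. *)
pose I v := if v == z then alpha z `&` [set x | x <= t] else
  if v \in S then alpha v `|` [set x | t <= x] else alpha v.
(* Adjacency survives: [z] and [S] all contain [t] before and after, while every other interval lies
   strictly left of [t], where the redrawing changes nothing. *)
have F1 v : (v == z) || (v \in S) -> alpha v t /\ I v t.
  rewrite /I; have [->|_ /= vS] := eqVneq v z; first by move=> _; do 2?split => /=.
  by rewrite vS; split; [exact: SP|right => /=].
have F2 v : ~~ ((v == z) || (v \in S)) ->
    I v = alpha v /\ forall x, alpha v x -> x < t.
  rewrite negb_or /I => /andP[vz vS]; rewrite (negbTE vz) (negbTE vS); split=> //.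
  move=> x vx; have [vH|vH] := boolP (v \in H); last exact: (Hright vz vH aH vx at_).
  rewrite ltNge; apply/negP => tx.
  (* By maximality [f v <= t], so a point of [alpha v] at or beyond [t] would put [t] in [alpha v]
     and [v] in [S]. *)
  have [vf _ _] := fP v vH.
  move: vS; rewrite inE vH /= => /asboolP; apply.
  by apply: (iA v).1 vf vx _ _; rewrite amax.
have F3 v x : x < t -> I v x <-> alpha v x.
  move=> xt; rewrite /I; case: ifP => [/eqP ->|_].
    by split=> [[]//|zx]; split=> //=; exact: ltW.
  case: ifP => _ //; split=> [[//|/=]|]; last by left.
  by rewrite leNgt xt.
have Irep : representation e I.
  split=> [v|v w vw].
    have [iv [x vx]] := iA v; rewrite /I; case: ifP => [/eqP vz|_].
      split; last by exists t; split => /=.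
      move=> x1 y1 [zx1 _] [zy1 /= y1t] s /andP[xs sy]; split=> /=.
        by apply: (iA z).1 zx1 zy1 _ _; rewrite xs.
      exact: le_trans y1t.
    case: ifP => [/SP vt|_]; last by split=> //; exists x.
    split; last by exists x; left.
    move=> x1 y1 vx1 _ s /andP[xs _]; have [ts|st] := leP t s; [by right|left].
    case: vx1 => [vx1|/= tx]; last by have := le_lt_trans (le_trans tx xs) st; rewrite ltxx.
    by apply: (iv _ _ vx1 vt); rewrite xs ltW.
  rewrite aA//; have [vT|vT] := boolP ((v == z) || (v \in S)); last first.
    have [E lt] := F2 v vT; rewrite E.
    by split=> -[x [vx wx]]; exists x; split=> //; apply/F3 => //; exact: lt.
  have [wT|wT] := boolP ((w == z) || (w \in S)); last first.
    have [E lt] := F2 w wT; rewrite E.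
    by split=> -[x [vx wx]]; exists x; split=> //; apply/F3 => //; exact: lt.
  by have [[? ?] [? ?]] := (F1 v vT, F1 w wT); split=> _; exists t.
(* The vertices of [S] now stick out of [I z], among them the contributor [c] through [t]. The
   vertices still contained avoid [t], so they were properly contained before. *)
have sub : contained I z \subset contained alpha z :\ c.
  apply/fintype.subsetP => w /in_contained[wz zw]; rewrite 2!inE.
  have Iz : I z = alpha z `&` [set x | x <= t] by rewrite /I eqxx.
  have wT : ~~ ((w == z) || (w \in S)).
    apply/negP => /orP[/eqP wz'|wS]; first by apply: zw; rewrite wz'.
    have : I w (t + 1).
      rewrite /I wS; have [wz'|_] := eqVneq w z; first by rewrite wz' (negbTE zS) in wS.
      by right => /=; rewrite lerDl.
    by move/wz; rewrite Iz => -[_ /=]; rewrite gerDl ler10.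
  have [E lt] := F2 w wT.
  apply/andP; split.
    by apply: contraNneq wT => ->; rewrite orbC inE cH; apply/orP; left; apply/asboolP.
  apply/in_contained; split; first by rewrite -E => x /wz; rewrite Iz => -[].
  by move=> /(_ _ zt)/lt; rewrite ltxx.
have := leq_trans (alpha_min Irep) (subset_leq_card sub).
have /in_contained cz := cC.
by rewrite (cardsD1 c (contained alpha z)) cz add1n ltnn.
Qed.

Variables (J : V -> set R) (K S : {set V}).
Hypothesis es : symmetric e.
Hypothesis J_rep : representation e J.
Hypothesis zK : z \notin K.
Hypothesis HK : H :&: K = finset.set0.
Hypothesis Kclosed : forall u v, u \in K -> v != z -> e u v -> v \in K.
Hypothesis Kcontained : K \subset contained alpha z.
Hypothesis JHK : forall h k, h \in H -> k \in K -> left_of (J h) (J k).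
Hypothesis H0 : exists h, h \in H.
Hypothesis SK : S \subset K.
Hypothesis SJ : forall s, s \in S -> ~ contributes z J s.

(* Deleting [K] and appending it, as drawn by [J], to the right of everything
   else turns [H] into contributors and [S] into non-contributors. *)
Lemma card_blocking_le : (#|S| <= #|H :\: contained alpha z|)%N.
Proof.
have [iA aA] := alpha_rep; have [iJ aJ] := J_rep.
have [S0|[s0 s0S]] := set_0Vmem S; first by rewrite S0 cards0.
have neqz v (A : {set V}) : z \notin A -> v \in A -> z != v.
  by move=> zA vA; apply: contraNneq zA => ->.
have Kadj k : k \in K -> e z k.
  move=> kK; apply/(aA _ _ (neqz _ _ zK kK)).
  have /in_contained kz := fintype.subsetP Kcontained k kK.
  by have [_ [x kx]] := iA k; exists x; split=> //; apply: kz.1.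
have [h hH] := H0.
have [p [zp hp]] := (aJ _ _ (neqz _ _ zH hH)).1 (Hadj hH).
have [q [zq hq]] := (aA _ _ (neqz _ _ zH hH)).1 (Hadj hH).
have pt v : exists y, v \in K -> J z y /\ J v y.
  have [vK|] := boolP (v \in K); last by exists 0.
  by have [y yP] := (aJ _ _ (neqz _ _ zK vK)).1 (Kadj v vK); exists y.
have [f fP] := choice pt.
have [a aK amax] : exists2 a, a \in K & forall v, v \in K -> f v <= f a.
  by apply: nonempty_argmax; exists s0; exact: (fintype.subsetP SK).
set t := f a in amax.
have [zt _] := fP a aK; rewrite -/t in zt.
(* The point [p] of [J z] lies in [J h], hence left of [K]. So a vertex of [S] can leave [J z] only
   on the right, beyond [t]. *)
have Sout s : s \in S -> J s t /\ exists2 x, J s x & t < x.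
  move=> sS; have sK := fintype.subsetP SK s sS; have [zs ss] := fP s sK.
  have [x sx nzx] : exists2 x, J s x & ~ J z x.
    apply: contrapT => nx; apply: (SJ sS); split.
      by move=> x sx; apply: contrapT => nzx; apply: nx; exists x.
    by move=> /(_ _ zp) sp; have := JHK hH sK hp sp; rewrite ltxx.
  have tx : t < x.
    rewrite ltNge; apply/negP => xt; apply: nzx.
    by apply: (iJ z).1 zp zt _ _; rewrite xt (ltW (JHK hH sK hp sx)).
  split; last by exists x.
  by apply: (iJ s).1 ss sx _ _; rewrite amax// ltW.
(* The new interval of [z] starts where the negative copy of [alpha z] starts and ends at the
   positive copy of [t]: far enough to meet all of [K], short enough for [S] to stick out. *)
pose Z := [set x | (exists2 y, to_neg (alpha z) y & y <= x) /\ x <= expR t].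
pose I v := if v == z then Z else juxtapose K J alpha v.
have Iz : I z = Z by rewrite /I eqxx.
have Iv v : v != z -> I v = juxtapose K J alpha v by rewrite /I => /negbTE ->.
have IK v : v \in K -> I v = to_pos (J v).
  by move=> vK; rewrite Iv 1?eq_sym ?(neqz _ K)// /juxtapose vK.
have InK v : v != z -> v \notin K -> I v = to_neg (alpha v).
  by move=> vz vK; rewrite Iv// /juxtapose (negbTE vK).
(* Everything but [z] is juxtaposed; [Kclosed] excludes edges between the two parts. *)
have [iG aG] : represents_on e (K :|: ~: (z |: K))%SET (juxtapose K J alpha).
  apply: juxtapose_on => //; try exact: representation_on.
  move=> v w vK wB wK; apply: contraNN wK; apply: Kclosed => //.
  by move: wB; rewrite !inE negb_or => /andP[].
have inG v : v != z -> v \in (K :|: ~: (z |: K))%SET.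
  by rewrite !inE negb_or => ->; rewrite orbN.
have posZ y : (exists2 x, to_neg (alpha z) x & x <= expR y) by
  exists (- expR (- q)); [exact/to_negE|apply: le_trans (expR_ge0 _); rewrite oppr_le0 expR_ge0].
have negZ x : alpha z x -> Z (- expR (- x)).
  move=> zx; split; first by exists (- expR (- x)) => //; exact/to_negE.
  by apply: le_trans (expR_ge0 _); rewrite oppr_le0 expR_ge0.
have below x : Z (- expR (- x)) -> exists2 y, alpha z y & y <= x.
  by case=> [[_ [y zy <-] le] _]; exists y => //; move: le; rewrite lerN2 ler_expR lerN2.
(* Prolonging [z] to the right creates no adjacency: outside [H], the old intervals lie left of the
   point [q] of [alpha z], and [H] is adjacent to [z] anyway. *)
have Zadj v : v != z -> e z v <-> Z `&` I v !=set0.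
  move=> vz; have [vK|vK] := boolP (v \in K).
    rewrite (Kadj v vK) IK//; split=> // _.
    have [zf vf] := fP v vK; exists (expR (f v)); split; last exact/to_posE.
    by split=> /=; [exact: posZ|rewrite ler_expR amax].
  rewrite InK//; split.
    rewrite aA 1?eq_sym// => -[x [zx vx]]; exists (- expR (- x)).
    by split; [exact: negZ|exact/to_negE].
  case=> y0 [] + [x vx xE]; rewrite -xE => Zx {y0 xE}.
  have [vH|vH] := boolP (v \in H); first exact: Hadj.
  have [y zy yx] := below x Zx.
  apply/(aA z v); first by rewrite eq_sym.
  exists x; split=> //; apply: (iA z).1 zy zq _ _.
  by rewrite yx (ltW (Hright vz vH hH vx hq)).
have Irep : representation e I.
  split=> [v|v w vw].
    have [->|vz] := eqVneq v z; last by rewrite Iv//; apply/iG/inG.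
    rewrite Iz; split; last by exists (- expR (- q)); exact: negZ.
    move=> x y [[u zu ux] _] [_ yt] s /andP[xs sy]; split; last exact: le_trans yt.
    by exists u => //; exact: le_trans xs.
  have [vz|vz] := eqVneq v z.
    by rewrite vz Iz; apply: Zadj; rewrite -vz eq_sym.
  have [wz|wz] := eqVneq w z.
    by rewrite wz es Iz setIC; exact: Zadj.
  by rewrite !Iv//; apply: aG => //; exact: inG.
(* At worst all of [H] contributes now; outside [H] and [K] there is no new contributor, and [S] is
   lost. *)
have sub : contained I z \subset
    (contained alpha z :\: (H :|: K)) :|: H :|: (K :\: S).
  apply/fintype.subsetP => w /in_contained[wz zw]; rewrite !inE.
  have nwz : w != z by apply: contra_not_neq zw => ->.
  have [wK|wK] := boolP (w \in K).
    rewrite andbT; apply/orP; right; apply/negP => wS.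
    have [_ [x wx tx]] := Sout w wS.
    have : I z (expR x) by apply: wz; rewrite IK//; exact/to_posE.
    by rewrite Iz => -[_ /=]; rewrite ler_expR leNgt tx.
  have [wH|wH] := boolP (w \in H); first by rewrite orbT.
  rewrite !orbF /= andbF orbF; apply/asboolP; split; last first.
    by move=> /(_ _ zq) wq; have := Hright nwz wH hH wq hq; rewrite ltxx.
  move=> x wx; have [y zy yx] : exists2 y, alpha z y & y <= x.
    by apply: below; rewrite -Iz; apply: wz; rewrite InK//; exact/to_negE.
  by apply: (iA z).1 zy zq _ _; rewrite yx (ltW (Hright nwz wH hH wx hq)).
(* Let [C] be [contained alpha z]. Cancelling the part of [C] outside [H] and [K] leaves
   [#|C :&: H| + #|K| <= #|H| + #|K :\: S|], which is the claim. *)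
have := leq_trans (alpha_min Irep) (subset_leq_card sub).
move=> /leq_trans -/(_ _ (leq_card_setU _ _).1).
rewrite -(cardsID (H :|: K) (contained alpha z)).
have -> : contained alpha z :&: (H :|: K) = (contained alpha z :&: H) :|: K.
  by rewrite finset.setIUr; congr (_ :|: _); exact/finset.setIidPr.
have := (leq_card_setU (contained alpha z :\: (H :|: K)) H).1.
have := cardsID (contained alpha z) H.
have := cardsID S K; rewrite (finset.setIidPr SK).
have := cardsUI (contained alpha z :&: H) K.
have -> : contained alpha z :&: H :&: K = finset.set0.
  by rewrite -finset.setIA HK finset.setI0.
rewrite cards0 (finset.setIC H).
lia.
Qed.

End Surgery.

(** * Connectedness of minimal forbidden graphs *)

Section Connectedness.
Local Open Scope classical_set_scope.
Variables (R : realType) (V : finType) (e : rel V).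
Implicit Types A : {set V}.

(** The whole line is a default value outside [A]; only the values on [A] enter below. *)
Definition extend A (I : {x : V | x \in A} -> set R) (v : V) : set R :=
  if insub v is Some u then I u else setT.

Lemma extendE A (I : {x : V | x \in A} -> set R) v (vA : v \in A) :
  extend I v = I (exist _ v vA).
Proof. by rewrite /extend (insubT (mem A) vA). Qed.

Lemma extend_represents_on A (I : {x : V | x \in A} -> set R) :
  representation (relpre val e) I -> represents_on e A (extend I).
Proof.
case=> i a; split=> [v vA|v w vA wA vw].
  by rewrite extendE; exact: i.
by rewrite !extendE -a.
Qed.

Lemma card_contained_extend A (I : {x : V | x \in A} -> set R) v p :
  v \in A -> (forall u, #|contained I u| <= p) ->
  #|[set w in A | `[< extend I w `<` extend I v >]]%SET| <= p.
Proof.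
move=> vA /(_ (exist _ v vA)); apply: leq_trans.
apply: leq_trans (leq_imset_card val _).
apply: subset_leq_card; apply/fintype.subsetP => w; rewrite inE => /andP[wA].
rewrite !extendE => /asboolP wv; apply/imsetP.
by exists (exist _ w wA) => //; apply/in_contained.
Qed.

(** With the two parts on opposite half-lines, no interval contains a nonempty one of the other
    part, so each count is one inside a single part. *)
Lemma improper_juxtapose p A : symmetric e ->
  (forall v w, v \in A -> w \notin A -> ~~ e v w) ->
  improper R (relpre (val : {x : V | x \in A} -> V) e) p ->
  improper R (relpre (val : {x : V | x \in (~: A)%SET} -> V) e) p ->
  improper R e p.
Proof.
move=> es nA [I1 r1 c1] [I2 r2 c2].
have s1 := extend_represents_on r1; have s2 := extend_represents_on r2.
have [s12 a12] := juxtapose_on es s1 s2 (fun v w vA _ wA => nA v w vA wA).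
exists (juxtapose A (extend I1) (extend I2)).
  split=> [v|v w]; first by apply: s12; rewrite finset.setUCr inE.
  by apply: a12; rewrite finset.setUCr inE.
move=> v; have [vA|vA] := boolP (v \in A).
  apply: leq_trans (card_contained_extend vA c1).
  apply: subset_leq_card; apply/fintype.subsetP => w /in_contained.
  rewrite /juxtapose vA inE; case: ifP => [wA /to_pos_proper wv|wA []].
    by apply/asboolP.
  have [|_ [x wx]] := s2.1 w; first by rewrite inE wA.
  move=> wv _; case: (@to_neg_pos_disjoint _ (extend I2 w) (extend I1 v)).
  have wx' : to_neg (extend I2 w) (- expR (- x))%R by apply/to_negE.
  by exists (- expR (- x))%R; split=> //; exact: wv.
have vA' : v \in (~: A)%SET by rewrite inE.
apply: leq_trans (card_contained_extend vA' c2).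
apply: subset_leq_card; apply/fintype.subsetP => w /in_contained.
rewrite /juxtapose (negbTE vA) 2!inE; case: ifP => [wA []|wA /to_neg_proper wv] /=.
  have [_ [x wx]] := s1.1 w wA.
  move=> wv _; case: (@to_neg_pos_disjoint _ (extend I2 v) (extend I1 w)).
  have wx' : to_pos (extend I1 w) (expR x) by apply/to_posE.
  by exists (expR x); split=> //; exact: wv.
exact/asboolP.
Qed.

(** Otherwise no edge leaves [K]. Both [K], which misses [z], and its nonempty-component complement
    induce proper subgraphs, whose drawings juxtapose to a [p]-improper one of the whole graph. *)
Lemma minimal_forbidden_local_component_adj z p (K : {set V}) : symmetric e ->
  minimal_forbidden R e p -> K \in local_components e z ->
  exists2 v, v \in K & e z v.
Proof.
move=> es [_ nimp sub] KL; have zK := local_component_notin es KL.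
apply: contrapT => nv; apply: nimp; apply: (@improper_juxtapose p K) => //.
- move=> v w vK wK; apply/negP => vw; have [wz|wz] := eqVneq w z.
    by apply: nv; exists v => //; rewrite es -wz.
  by move: wK; rewrite (local_component_adj es KL vK wz vw).
- by apply: sub; apply/properP; split; [exact: finset.subsetT|exists z; rewrite ?inE].
- have [v vK] := local_component_nonempty KL.
  by apply: sub; apply/properP; split; [exact: finset.subsetT|exists v; rewrite ?inE ?vK].
Qed.

End Connectedness.

(** * Structure of a confined, non-exterior side component *)

Lemma theorem8_rightmost (R : realType) (V : finType) (e : rel V) (p : nat)
    (z : V) (alpha : V -> set R) (H : {set V}) :
  symmetric e ->
  minimal_forbidden R e p ->
  basepoint R e z ->
  minimal_representation e alpha ->
  H \in local_components e z ->
  (forall K, K \in local_components e z -> K != H ->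
    left_of (Defs.support alpha K) (Defs.support alpha H)) ->
  ~ exterior e z H ->
  confined R e z H ->
  exists B C : {set V},
    [/\ H = B :|: C,
        blocking_set e z alpha B,
        forall S : {set V},
          interior_potential_blocking_set e z alpha S -> #|S| <= #|B|,
        forall v, v \in C -> contributes z alpha v
      & 1 <= #|[set b in B | [exists c in C, e b c]]%SET| <= #|B| - 1].
Proof.
move=> es Gmin zbase [arep amax] HL Hmax nH [_ Hconf].
have zH := local_component_notin es HL.
have [iA aA] := arep.
have nz h : h \in H -> h != z by apply: contraTneq => ->.
(* Minimality bounds the left side by the impropriety, and the basepoint property bounds the right
   side below by it. *)
have alpha_min (I : V -> set R) :
    representation e I -> #|contained alpha z| <= #|contained I z|.
  move=> Irep; apply: leq_trans (zbase I Irep); rewrite -amax.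
  by rewrite (bigD1 z) //= leq_maxl.
have Hadj h : h \in H -> e z h.
  by move=> hH; apply: (non_exterior_adj nH) => //; exact: nz.
have Hright w h : w != z -> w \notin H -> h \in H -> left_of (alpha w) (alpha h).
  move=> wz wH hH x y wx hy; have [K KL wK] := local_component_cover e wz.
  apply: (Hmax K KL); [|by exists w|by exists h].
  by apply: contraNneq wH => <-.
have Hnonempty := local_component_nonempty HL.
have [c cH cC] := Hconf alpha arep.
have [b [bH nbC bfree]] : exists b, [/\ b \in H, ~ contributes z alpha b &
    forall c, c \in H -> contributes z alpha c -> ~~ e b c].
  by apply: exists_free_outer_vertex => //; exists c.
have bB : b \in H :\: contained alpha z.
  by rewrite finset.inE bH andbT; apply/negP => /in_contained.
exists (H :\: contained alpha z), (H :&: contained alpha z); split.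
- by rewrite finset.setUC finset.setID.
- move=> v; rewrite finset.inE => /andP[vC vH]; split; first exact: Hadj.
    by move/in_contained; apply/negP.
  (* An exterior vertex is not [z], by the empty walk; as a neighbour of [v] it would lie in [H] and
     make [H] exterior. *)
  move=> w wext; apply/negP => vw; apply: nH; exists w => //.
  apply: (local_component_adj es HL vH _ vw); apply/eqP => wz.
  by have := wext [::] isT (esym wz).
- move=> S [[J Jrep Jblock] [K [[_ _ [KL _]] nK SK]]].
  have KH : K != H.
    by apply: contra_not_neq nK => ->; split=> //; right.
  have zK := local_component_notin es KL.
  have nzK k : k \in K -> k != z by apply: contraTneq => ->.
  (* [K] is not leftmost, so some component [L] precedes it. A neighbour of [z] in [L] and one in
     [H] give points [q] and [r] of [alpha z] enclosing all of [K]. *)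
  have [L [LL LK]] : exists L, [/\ L \in local_components e z,
      left_of (Defs.support alpha L) (Defs.support alpha K) & True].
    apply: contrapT => nL; apply: nK; split=> //; left=> L LL LK.
    case: (support_total es arep LL KL LK) => // LK'.
    by case: nL; exists L.
  move=> _; have [l lL zl] := minimal_forbidden_local_component_adj es Gmin LL.
  have zl' : z != l.
    by apply: contraTneq lL => <-; exact: local_component_notin.
  have [q [zq lq]] := (aA _ _ zl').1 zl.
  have [h hH] := Hnonempty.
  have zh : z != h by rewrite eq_sym nz.
  have [r [zr hr]] := (aA _ _ zh).1 (Hadj h hH).
  have Kcont : K \subset contained alpha z.
    apply/fintype.subsetP => k kK; apply/in_contained.
    have qk x : alpha k x -> (q < x)%R by move=> kx; apply: LK; [exists l|exists k].
    split=> [x kx|]; last by move=> /(_ _ zq)/qk; rewrite ltxx.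
    apply: (iA z).1 zq zr _ _; rewrite (ltW (qk _ kx)) ltW//.
    by apply: (Hmax K KL KH); [exists k|exists h].
  have HK0 : H :&: K = finset.set0.
    apply/eqP; apply: contraNT KH => /finset.set0Pn[v]; rewrite inE => /andP[vH vK].
    by rewrite (local_component_eq es HL KL vH vK).
  have Kclosed u v : u \in K -> v != z -> e u v -> v \in K.
    exact: local_component_adj.
  have SJ s : s \in S -> ~ contributes z J s by move=> /Jblock[].
  have HK : H != K by rewrite eq_sym.
  (* If [J] draws [K] to the left of [H], its mirror image is used, with the same
     non-contributors. *)
  have [JHK|JKH] := support_total es Jrep HL KL HK.
    apply: (@card_blocking_le R V e z alpha arep alpha_min H zH Hright Hadj
      (J) K) => //.
    by move=> h' k h'H kK x y hx ky; apply: JHK; [exists h'|exists k].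
  apply: (@card_blocking_le R V e z alpha arep alpha_min H zH Hright Hadj
      (reflect_rep J) K) => //.
  + exact: reflect_rep_representation.
  + have {}JKH := (reflect_rep_left_of J H K).2 JKH.
    by move=> h' k h'H kK x y hx ky; apply: JKH; [exists h'|exists k].
  + by move=> s /SJ; rewrite reflect_rep_contributes.
- by move=> v; rewrite inE => /andP[_ /in_contained].
- apply/andP; split.
    (* Without an edge between the two sets, contributing would spread from [c] through the
       connected [H] to [b]. *)
    rewrite card_gt0; apply/negP => /eqP nBC; apply: nbC; apply/in_contained.
    apply: (@local_component_connected _ _ z es H (fun v => v \in contained alpha z) c) => //.
      move=> u v uH vH uv uC; apply: contraT => vC.
      rewrite -(finset.in_set0 v) -nBC finset.inE finset.in_setD vC vH /=.
      by apply/existsP; exists u; rewrite finset.in_setI uH uC es.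
    exact/in_contained.
  (* The vertex [b] has no contributing neighbour, so the counted vertices lie in the first set
     minus [b]. *)
  rewrite (cardsD1 b (H :\: _)) bB addKn.
  apply: subset_leq_card; apply/fintype.subsetP => v; rewrite finset.inE => /andP[vB].
  case/existsP => u /andP[]; rewrite finset.inE => /andP[uH /in_contained uC] vu.
  rewrite finset.in_setD1 vB andbT; apply: contraTneq vu => ->; exact: bfree.
Qed.

(** A leftmost component is rightmost in the mirror image, and reflection preserves contributors,
    side components and minimality. *)
Theorem theorem8 (R : realType) (V : finType) (e : rel V) (p : nat) (z : V)
    (alpha : V -> set R) (H : {set V}) :
  symmetric e -> irreflexive e ->
  minimal_forbidden R e p ->
  basepoint R e z ->
  minimal_representation e alpha ->
  side_component e z alpha H ->
  ~ exterior e z H ->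
  confined R e z H ->
  exists B C : {set V},
    [/\ H = B :|: C,
        blocking_set e z alpha B,
        forall S : {set V},
          interior_potential_blocking_set e z alpha S -> #|S| <= #|B|,
        forall v, v \in C -> contributes z alpha v
      & 1 <= #|[set b in B | [exists c in C, e b c]]%SET| <= #|B| - 1].
Proof.
move=> es _ Gmin zbase amin [HL Hside] nH Hconf.
case: Hside => Hside; last exact: (theorem8_rightmost es Gmin zbase amin HL).
have [arep amax] := amin.
have rmin : minimal_representation e (reflect_rep alpha).
  split; first exact: reflect_rep_representation.
  by rewrite -amax; apply: eq_bigr => v _; rewrite reflect_rep_contained.
have [|B [C [HBC Bblock Bmax Ccontr BC]]] :=
    theorem8_rightmost es Gmin zbase rmin HL _ nH Hconf.
  by move=> K KL KH; apply/reflect_rep_left_of; exact: Hside.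
exists B, C; split=> // [v vB|S [Spot [K [Kpot nK SK]]]|v /Ccontr].
- by have := Bblock v vB; rewrite reflect_rep_contributes.
- apply: Bmax; split=> //; exists K; split=> //.
  by move/reflect_rep_side_component.
- by rewrite reflect_rep_contributes.
Qed.
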